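(* Let $A=[(A_\varepsilon)_\varepsilon]\in M_n(\widetilde{\mathbb{K}}_c)$ be a hermitian matrix and let $u,v\in\mathbb{C}^n$ be fixed orthogonal vectors of norm one. Put $\nu(A)=[\varepsilon\mapsto|\langle u,\exp(iA_\varepsilon)v\rangle|]\in\overline{\mathbb{R}}$ and, for $A_0\in M_n(\mathbb{K})$, $\nu(A_0)=|\langle u,\exp(iA_0)v\rangle|\in\mathbb{R}$. Then $$\mathrm{supp}(\nu(A))=\{\nu(A_0):A_0\in\mathrm{supp}(A)\}.$$
   Context: Let $\mathbb{K}\in\{\mathbb{R},\mathbb{C}\}$ and $I=\,]0,1]$. A net $x\in\mathbb{K}^I$ is moderate if there is $n\in\mathbb{Z}$ with $|x(\varepsilon)|\le\varepsilon^n$ for all sufficiently small $\varepsilon$, and null if for every $q\in\mathbb{N}$ one has $|x(\varepsilon)|\le\varepsilon^q$ for all sufficiently small $\varepsilon$. The ring of Colombeau generalized numbers is $\overline{\mathbb{K}}=\{\text{moderate nets}\}/\{\text{null nets}\}$; the class of $(x_\varepsilon)$ is written $[(x_\varepsilon)]$. $\widetilde{\mathbb{K}}_c$ is the set of compactly supported generalized numbers: those $x\in\overline{\mathbb{K}}$ having a representative $(x_\varepsilon)$ and an $\eta>0$ such that $\{x_\varepsilon:\varepsilon<\eta\}$ is relatively compact in $\mathbb{K}$. The support of $p=[(p_\varepsilon)]\in\overline{\mathbb{C}}^m$ (in particular of a generalized number, or of a matrix viewed as an element of $\overline{\mathbb{C}}^{n^2}$) is $\mathrm{supp}(p)=\{q\in\mathbb{C}^m:\exists\,\varepsilon_k\to0,\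 p_{\varepsilon_k}\to q\}$. A matrix over $\overline{\mathbb{K}}$ is hermitian if it equals its conjugate transpose; representatives $(A_\varepsilon)$ are chosen hermitian for every $\varepsilon$. $\langle\cdot,\cdot\rangle$ is the standard hermitian product on $\mathbb{C}^n$. *)

(* Defs.v *)
From HB Require Import structures.
From mathcomp Require Import all_boot all_order all_algebra.
From mathcomp Require Import all_classical all_reals all_analysis.
From mathcomp Require Import generic_quotient ring_quotient sesquilinear spectral.
From mathcomp Require Import complex.

Set Implicit Arguments.
Unset Strict Implicit.
Unset Printing Implicit Defensive.

Import Order.TTheory GRing.Theory Num.Theory.
Import numFieldNormedType.Exports.

Local Open Scope classical_set_scope.
Local Open Scope ring_scope.
Local Open Scope quotient_scope.
Local Open Scope sesquilinear_scope.

(* The real-closed library puts no topology on R[i]; give it the one of the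
   modulus, i.e. the one every numFieldType carries. *)
Set Warnings "-redundant-canonical-projection".
HB.instance Definition _ (R : rcfType) :=
  NormedModule.copy R[i] (R[i] : numClosedFieldType)^o.
Set Warnings "redundant-canonical-projection".

(* K = R is the subfield of real elements of R[i], so that real generalized
   numbers, and their supports, live in C without any embedding. *)
Inductive scalar_field := RealScalars | ComplexScalars.

Definition scalars (R : realType) (K : scalar_field) : {pred R[i]} :=
  fun z => if K is RealScalars then z \is Num.real else true.

(* The index set I = ]0, 1]. *)
Definition eps01 (R : realType) := {e : R | 0 < e <= 1}.

Section Eps01.
Variable R : realType.
HB.instance Definition _ := SubChoice.on (eps01 R).
Lemma eps01_1 : (0 : R) < 1 <= (1 : R). Proof. by rewrite ltr01 lexx. Qed.
HB.instance Definition _ :=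
  isPointed.Build (eps01 R) (exist (fun e : R => 0 < e <= 1) 1 eps01_1).
End Eps01.

Definition small_eps (R : realType) (P : eps01 R -> Prop) : Prop :=
  exists2 eta : R, 0 < eta & forall e : eps01 R, val e < eta -> P e.

Definition moderate (R : realType) (K : scalar_field) :
    {pred (eps01 R -> R[i])} :=
  fun x => `[< (forall e, x e \in scalars K) /\
    exists n : int, small_eps (fun e => `|x e| <= (val e ^ n)%:C%C) >].

Section ModerateRing.
Variables (R : realType) (K : scalar_field).
Implicit Types (e : eps01 R) (x y : eps01 R -> R[i]).

Lemma eps_gt0 e : 0 < val e. Proof. by case/andP: (valP e). Qed.
Lemma eps_le1 e : val e <= 1. Proof. by case/andP: (valP e). Qed.

Lemma small_epsI (P Q : eps01 R -> Prop) :
  small_eps P -> small_eps Q -> small_eps (fun e => P e /\ Q e).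
Proof.
move=> [a a0 Pa] [b b0 Qb]; exists (Num.min a b); first by rewrite lt_min a0.
by move=> e; rewrite lt_min => /andP[ea eb]; split; [exact: Pa|exact: Qb].
Qed.

Lemma small_epsW (P Q : eps01 R -> Prop) :
  (forall e, P e -> Q e) -> small_eps P -> small_eps Q.
Proof. by move=> PQ [a a0 Pa]; exists a => // e /Pa /PQ. Qed.

Lemma small_eps_le2 : small_eps (fun e => val e * 2 <= 1).
Proof.
exists 2^-1; first by rewrite invr_gt0.
by move=> e /ltW; rewrite -[leRHS]mul1r ler_pdivlMr.
Qed.

Lemma scalarsE (z : R[i]) :
  (z \in scalars K) = if K is RealScalars then z \is Num.real else true.
Proof. by []. Qed.

Lemma scalarsB (a b : R[i]) :
  a \in scalars K -> b \in scalars K -> a - b \in scalars K.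
Proof. by rewrite !scalarsE; case: K => // *; apply: rpredB. Qed.

Lemma scalarsM (a b : R[i]) :
  a \in scalars K -> b \in scalars K -> a * b \in scalars K.
Proof. by rewrite !scalarsE; case: K => // *; apply: rpredM. Qed.

Lemma scalars1 : (1 : R[i]) \in scalars K.
Proof. by rewrite !scalarsE; case: K => //; apply: rpred1. Qed.

Lemma scalars_conj (a : R[i]) : a \in scalars K -> a^* \in scalars K.
Proof. by rewrite !scalarsE; case: K => // ?; rewrite conj_Creal. Qed.

Lemma moderateP x : reflect ((forall e, x e \in scalars K) /\
    exists N : nat, small_eps (fun e => `|x e| <= (val e ^- N)%:C%C))
  (x \in moderate K).
Proof.
apply: (iffP (asboolP _)) => -[xK]; last first.
  case=> N xN; split=> //; exists (- N%:Z).
  by apply: small_epsW xN => e; rewrite -exprnN.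
case=> -[] p xp; split=> //; last by exists p.+1.
exists 0%N; apply: small_epsW xp => e /le_trans; apply.
by rewrite lecR expr0 invr1 exprn_ile1 ?eps_le1 // ltW ?eps_gt0.
Qed.

Lemma moderate_subring : subring_closed (@moderate R K).
Proof.
split=> [|x y|x y].
- apply/moderateP; split=> [e|]; first exact: scalars1.
  exists 0%N; exists 1 => // e _.
  by rewrite expr0 invr1 normr1.
- move=> /moderateP[xK [M xM]] /moderateP[yK [N yN]].
  apply/moderateP; split=> [e|]; first exact: scalarsB.
  exists (M + N).+1; apply: small_epsW (small_epsI small_eps_le2 (small_epsI xM yN)).
  move=> e [e2 [xe ye]]; have e0 := eps_gt0 e; have e1 := eps_le1 e.
  apply: (le_trans (ler_normB _ _)); apply: (le_trans (lerD xe ye)).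
  rewrite -rmorphD lecR.
  have H p q : val e ^- p <= val e ^- (p + q).
    rewrite lef_pV2 ?posrE ?exprn_gt0 // exprD ler_piMr ?exprn_ge0 ?(ltW e0) //.
    by rewrite exprn_ile1 // ltW.
  apply: (le_trans (lerD (H M N) (H N M))).
  rewrite [(N + M)%N]addnC -mulr2n -mulr_natr exprS invfM [leRHS]mulrC.
  by rewrite ler_pM2l ?invr_gt0 ?exprn_gt0 // -[leRHS]mul1r ler_pdivlMr // mulrC.
- move=> /moderateP[xK [M xM]] /moderateP[yK [N yN]].
  apply/moderateP; split=> [e|]; first exact: scalarsM.
  exists (M + N)%N; apply: small_epsW (small_epsI xM yN) => e [xe ye].
  by rewrite normrM exprD invfM rmorphM ler_pM.
Qed.

HB.instance Definition _ := GRing.isSubringClosed.Build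
  (eps01 R -> R[i]) (moderate K) moderate_subring.

Definition moderate_net := {x : eps01 R -> R[i] | x \in moderate K}.
HB.instance Definition _ := SubChoice.on moderate_net.
HB.instance Definition _ := [SubChoice_isSubComNzRing of moderate_net by <:].

Definition null_net : {pred moderate_net} :=
  fun m : moderate_net => `[< forall q : nat,
    small_eps (fun e => `|val m e| <= (val e ^+ q)%:C%C) >].

Lemma null_ideal : idealr_closed null_net.
Proof.
split=> [||a x y xn yn].
- apply/asboolP => q; exists 1 => // e _; rewrite normr0.
  by rewrite -(rmorph0 (real_complex R)) lecR exprn_ge0 // ltW // eps_gt0.
- apply/asboolP => /(_ 1%N) [eta eta0 H].
  have [e [e_eta e_half]] : exists e : eps01 R, val e < eta /\ val e < 1.
    have m0 : 0 < Num.min eta 1 by rewrite lt_min eta0 ltr01.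
    have mlt : Num.min eta 1 / 2 < Num.min eta 1.
      by rewrite ltr_pdivrMr // ltr_pMr // ltr1n.
    have h : 0 < Num.min eta 1 / 2 <= 1.
      rewrite divr_gt0 //= (le_trans (ltW mlt)) // ge_min lexx orbT //.
    exists (exist (fun e : R => 0 < e <= 1) _ h) => /=; split; apply: (lt_le_trans mlt).
      by rewrite ge_min lexx.
    by rewrite ge_min lexx orbT.
  have := H e e_eta; rewrite expr1 [`|_|]normr1 -(rmorph1 (real_complex R)) lecR.
  by rewrite leNgt e_half.
- move: xn yn => /asboolP xn /asboolP yn; apply/asboolP => q.
  have /moderateP[_ [N aN]] := valP a.
  apply: small_epsW (small_epsI small_eps_le2
    (small_epsI aN (small_epsI (xn (q.+1 + N)%N) (yn q.+1)))).
  move=> e [e2 [ae [xe ye]]]; have e0 := eps_gt0 e.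
  apply: (le_trans (ler_normD _ _)); rewrite [X in `|X| + _](_ : _ = val a e * val x e) //.
  rewrite normrM.
  apply: (@le_trans _ _ ((val e ^+ q.+1)%:C%C + (val e ^+ q.+1)%:C%C)).
    apply: lerD => //; apply: (le_trans (ler_pM _ _ ae xe)) => //.
    by rewrite -rmorphM exprD mulrCA mulVf ?mulr1 // expf_neq0 // gt_eqF.
  rewrite -rmorphD lecR -mulr2n -mulr_natr exprSr -mulrA ler_piMr //.
  by rewrite exprn_ge0 // ltW.
Qed.

HB.instance Definition _ := isIdealr.Build moderate_net null_net null_ideal.

(* The ring of Colombeau generalized numbers. *)
Definition gen_num := {ideal_quot null_net}.
HB.instance Definition _ := GRing.ComNzRing.on gen_num.

(* p = [(x_e)_e], which includes that x is moderate with values in K. *)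
Definition represents x (p : gen_num) : Prop :=
  exists2 m : moderate_net, val m = x & p = \pi_gen_num m.

Lemma moderate_conj (m : moderate_net) : (fun e => (val m e)^*) \in moderate K.
Proof.
have /moderateP[mK [N mN]] := valP m; apply/moderateP; split.
  by move=> e; exact: scalars_conj.
by exists N; apply: small_epsW mN => e; rewrite norm_conjC.
Qed.

Definition conj_net (m : moderate_net) : moderate_net :=
  exist (fun x => x \in moderate K) _ (moderate_conj m).

(* Does not depend on the representative: gen_conj_represents. *)
Definition gen_conj (p : gen_num) : gen_num := \pi_gen_num (conj_net (repr p)).

Definition compactly_supported (p : gen_num) : Prop :=
  exists2 x, represents x p & exists2 eta : R, 0 < eta &
    precompact [set x e | e in [set e | val e < eta]].

End ModerateRing.

(* The limit points of a net as e -> 0. *)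
Definition net_supp (R : realType) (T : topologicalType) (x : eps01 R -> T) :
    set T :=
  [set q | exists2 eps_ : nat -> eps01 R,
     (fun k => val (eps_ k)) @ \oo --> (0 : R) & x (eps_ k) @[k --> \oo] --> q].

Section Supports.
Variables (R : realType) (K : scalar_field).

(* Any one representative yields the same set: gen_suppE, mx_suppE. *)
Definition gen_supp (p : gen_num R K) : set R[i] :=
  [set q | exists2 x, represents x p & net_supp x q].

Definition mx_represents m n (x : eps01 R -> 'M[R[i]]_(m, n))
    (p : 'M[gen_num R K]_(m, n)) : Prop :=
  forall i j, represents (fun e => x e i j) (p i j).

Definition mx_supp m n (p : 'M[gen_num R K]_(m, n)) : set 'M[R[i]]_(m, n) :=
  [set q | exists2 x, mx_represents x p & net_supp x q].

Definition gen_hermitian n (A : 'M[gen_num R K]_n) : Prop :=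
  A = map_mx (@gen_conj R K) A^T.

Lemma represents_pi (m : moderate_net R K) :
  represents (val m) (\pi_(gen_num R K) m).
Proof. by exists m. Qed.

Lemma piE_null (m1 m2 : moderate_net R K) :
  \pi_(gen_num R K) m1 = \pi_(gen_num R K) m2 <-> m1 - m2 \in @null_net R K.
Proof. by split; [move/eqP; rewrite -Quotient.idealrBE|move=> h; apply/eqP; rewrite -Quotient.idealrBE]. Qed.

Lemma represents_null (x y : eps01 R -> R[i]) (p : gen_num R K) q :
  represents x p -> represents y p ->
  small_eps (fun e => `|x e - y e| <= (val e ^+ q)%:C%C).
Proof. by move=> [m <- ->] [m' <- /piE_null /asboolP]; apply. Qed.

Lemma gen_conj_represents (x : eps01 R -> R[i]) (p : gen_num R K) :
  represents x p -> represents (fun e => (x e)^*) (gen_conj p).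
Proof.
move=> [m <- ->]; exists (conj_net m) => //; apply/piE_null/asboolP => q.
have : \pi_(gen_num R K) (repr (\pi_(gen_num R K) m)) = \pi_(gen_num R K) m.
  by rewrite reprK.
move=> /piE_null /asboolP /(_ q); apply: small_epsW => e /=.
rewrite [X in _ -> `|X| <= _](_ : _ = (val (repr (\pi_(gen_num R K) m) - m) e)^*) ?norm_conjC //.
by rewrite rmorphB.
Qed.

Lemma small_eps_cvg (P : eps01 R -> Prop) (eps_ : nat -> eps01 R) :
  (fun k => val (eps_ k)) @ \oo --> (0 : R) -> small_eps P ->
  \forall k \near \oo, P (eps_ k).
Proof.
move=> /cvgrPdist_lt e0 [eta eta0 He]; near=> k; apply: He.
rewrite -[ltLHS]gtr0_norm ?eps_gt0 // -normrN -[X in `|X|]add0r.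
by near: k; exact: e0.
Unshelve. all: by end_near. Qed.

Lemma net_cvg_represents (x y : eps01 R -> R[i]) (p : gen_num R K)
    (eps_ : nat -> eps01 R) (q : R[i]) :
  represents x p -> represents y p ->
  (fun k => val (eps_ k)) @ \oo --> (0 : R) ->
  x (eps_ k) @[k --> \oo] --> q -> y (eps_ k) @[k --> \oo] --> q.
Proof.
move=> xp yp e0 /cvgrPdist_lt xq; apply/cvgrPdist_lt => d d0.
have [d' d'0 d'd] : exists2 d' : R, 0 < d' & d'%:C%C = d.
  by case: d d0 => a b; rewrite ltcE /= => /andP[/eqP -> a0]; exists a.
have hxy := small_eps_cvg e0 (represents_null 1 xp yp).
have hd : \forall k \near \oo, val (eps_ k) <= d' / 2.
  apply: (@small_eps_cvg (fun e => val e <= d' / 2)) e0 _.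
  by exists (d' / 2); [rewrite divr_gt0|move=> e /ltW].
near=> k.
rewrite -[X in `|X|](subrKA (x (eps_ k))) (splitr d).
apply: (le_lt_trans (ler_normD _ _)); apply: ltr_leD.
  by near: k; apply: xq; rewrite divr_gt0.
apply: (@le_trans _ _ (val (eps_ k) ^+ 1)%:C%C).
  by near: k; exact: hxy.
have -> : d / 2 = (d' / 2)%:C%C by rewrite -d'd fmorph_div rmorph_nat.
rewrite lecR expr1.
by near: k; exact: hd.
Unshelve. all: by end_near. Qed.

Lemma gen_suppE (x : eps01 R -> R[i]) (p : gen_num R K) :
  represents x p -> gen_supp p = net_supp x.
Proof.
move=> xp; apply/seteqP; split=> [q [y yp [eps_ e0 yq]]|q xq]; last by exists x.
by exists eps_ => //; exact: net_cvg_represents yp xp e0 yq.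
Qed.

Lemma cvg_mxP m n (F : set_system nat) {FF : Filter F} (f : nat -> 'M[R[i]]_(m, n))
    (q : 'M[R[i]]_(m, n)) :
  f @ F --> q <-> forall i j, f k i j @[k --> F] --> q i j.
Proof.
split=> [fq i j|fq].
  exact: (cvg_comp _ _ fq (@coord_continuous _ _ _ i j q)).
move=> A [P qP PA]; rewrite nbhs_simpl /=.
suff : \forall k \near F, forall i j, P i j (f k i j) by apply: filterS => k ?; exact: PA.
apply: filter_forall => i; apply: filter_forall => j; exact: fq.
Qed.

Lemma mx_suppE m n (x : eps01 R -> 'M[R[i]]_(m, n)) (p : 'M[gen_num R K]_(m, n)) :
  mx_represents x p -> mx_supp p = net_supp x.
Proof.
move=> xp; apply/seteqP; split=> [q [y yp [eps_ e0 yq]]|q xq]; last by exists x.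
exists eps_ => //; apply/cvg_mxP => i j.
apply: net_cvg_represents (yp i j) (xp i j) e0 _.
exact: (cvg_mxP _ _).1 yq i j.
Qed.

Lemma null_represents (x z : eps01 R -> R[i]) (p : gen_num R K) :
  represents x p -> (forall e, z e \in scalars K) ->
  (forall q, small_eps (fun e => `|x e - z e| <= (val e ^+ q)%:C%C)) ->
  represents z p.
Proof.
move=> [m <- ->] zK mz.
have dm : val m - z \in moderate K.
  apply/moderateP; split=> [e|]; last first.
    by exists 0%N; apply: small_epsW (mz 0%N) => e; rewrite expr0 invr1.
  by apply: scalarsB => //; have /moderateP[mK _] := valP m; exact: mK.
have zm : z \in moderate K.
  by rewrite -(subKr (val m) z); apply: rpredB => //; exact: (valP m).
exists (exist (fun x => x \in moderate K) _ zm) => //.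
by apply/piE_null/asboolP => q; exact: mz.
Qed.

Lemma scalars_half (a b : R[i]) :
  a \in scalars K -> b \in scalars K -> (a + b) / 2 \in scalars K.
Proof.
by rewrite !scalarsE; case: K => // aR bR; apply: rpred_div; [exact: rpredD|exact: rpred_nat].
Qed.

(* The hermitian representatives required in the main statement do exist. *)
Lemma hermitian_representative n (A : 'M[gen_num R K]_n) :
  gen_hermitian A ->
  exists2 A_, mx_represents A_ A & forall e : eps01 R, A_ e \is hermsymmx.
Proof.
move=> Aherm.
pose B e : 'M[R[i]]_n := \matrix_(i, j) val (repr (A i j)) e.
have BA : mx_represents B A.
  move=> i j; exists (repr (A i j)); last by rewrite reprK.
  by apply/funext => e; rewrite mxE.
pose D e : 'M[R[i]]_n := map_mx Num.conj_op (B e)^T.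
have DA : mx_represents D A.
  move=> i j; rewrite Aherm !mxE; have := gen_conj_represents (BA j i).
  by congr represents; apply/funext => e; rewrite !mxE.
have repK (x : eps01 R -> R[i]) (p : gen_num R K) e :
    represents x p -> x e \in scalars K.
  by case=> m <- _; have /moderateP[mK _] := valP m; exact: mK.
exists (fun e => 2^-1 *: (B e + D e)) => [i j|e].
  apply: (null_represents (BA i j)) => [e|q].
    rewrite !mxE mulrC; apply: scalars_half.
      by have := repK _ _ e (BA i j); rewrite mxE.
    by have := repK _ _ e (DA i j); rewrite !mxE.
  apply: small_epsW (represents_null q (BA i j) (DA i j)) => e; apply: le_trans.
  rewrite [X in `|X| <= _](_ : _ = 2^-1 * (B e i j - D e i j)); last first.
    rewrite [X in _ - X]mxE [X in _ - _ * X]mxE.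
    move: (B e i j) (D e i j) => a b.
    by rewrite ![2^-1 * _]mulrC !mulrDl mulNr {1}(splitr a) opprD addrA addrK.
  by rewrite normrM ger0_norm ?invr_ge0 // ler_piMl // invf_le1 // ler1n.
apply/is_hermitianmxP; rewrite expr0 scale1r; apply/matrixP => i j.
rewrite !mxE rmorphM rmorphD /= conjCK fmorphV rmorph_nat.
by congr (_ * _); rewrite addrC.
Qed.

End Supports.

Section Exponential.
Variable R : realType.

Definition expmx n (A : 'M[R[i]]_n) : 'M[R[i]]_n :=
  limn (series (fun k => (k`!%:R)^-1 *: A ^+ k)).

Definition hdot n (u v : 'cV[R[i]]_n) : R[i] := dotmx u^T v^T.

Lemma hdotE n (u v : 'cV[R[i]]_n) : hdot u v = \sum_i u i 0 * (v i 0)^*.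
Proof. by rewrite /hdot dotmxE mxE; apply: eq_bigr => i _; rewrite !mxE. Qed.

Definition vnorm n (u : 'cV[R[i]]_n) : R[i] := sqrtC (hdot u u).

Definition nu n (u v : 'cV[R[i]]_n) (A : 'M[R[i]]_n) : R[i] :=
  `|hdot u (expmx ('i *: A) *m v)|.

End Exponential.

(* Main.v *)
(* The map nu is continuous on matrices: the entries of the terms of the
   exponential series of A are dominated by those of exp (n M) as soon as the
   entries of A are bounded by M, so the partial sums converge uniformly on
   bounded sets. Compact supports let one extract, from any sequence
   eps_k -> 0, a subsequence along which A_(eps_k) converges; this yields the
   inclusion from left to right, and also, by contradiction, that nu(A) is
   moderate. The converse inclusion is continuity alone. *)
Require Import Defs.
From mathcomp Require Import all_boot all_order all_algebra.
From mathcomp Require Import all_classical all_reals all_analysis.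
From mathcomp Require Import sesquilinear spectral complex.
From mathcomp Require Import ring.
Import Order.TTheory GRing.Theory Num.Theory.
Import numFieldNormedType.Exports.
Local Open Scope classical_set_scope.
Local Open Scope ring_scope.

Section ExponentialContinuity.
Set Implicit Arguments.
Unset Strict Implicit.
Context {R : realType}.

(** * Tail estimates for dominated series *)

Lemma Re_series (x : nat -> R[i]) m :
  complex.Re (series x m) = series (fun k => complex.Re (x k)) m.
Proof. by rewrite !seriesEnat /= raddf_sum. Qed.

Lemma Im_series (x : nat -> R[i]) m :
  complex.Im (series x m) = series (fun k => complex.Im (x k)) m.
Proof. by rewrite !seriesEnat /= raddf_sum. Qed.

(** For [p >= m] the block of [f] from [m] to [p] is at most the block of [c], hence at most the
    tail of [c]; let [p] tend to infinity. *)
Lemma series_tail_le (f c : nat -> R) :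
  (forall k, `|f k| <= c k) -> cvgn (series c) ->
  forall m, `|limn (series f) - series f m| <= limn (series c) - series c m.
Proof.
move=> fc cc.
have c0 k : 0 <= c k := le_trans (normr_ge0 _) (fc k).
have cf : cvgn (series f).
  apply: normed_cvg.
  by apply: (@series_le_cvg _ (fun k => `|f k|) c) => // k; exact: normr_ge0.
move=> m.
have ndc : nondecreasing_seq (series c) by apply: nondecreasing_series => k _ _; exact: c0.
have cd : series f k - series f m @[k --> \oo] --> limn (series f) - series f m.
  by apply: cvgB cf _; exact: cvg_cst.
have cn : `|series f k - series f m| @[k --> \oo] --> `|limn (series f) - series f m|.
  exact: cvg_norm cd.
rewrite -(cvg_lim _ cn) //; apply: limr_le; first by apply/cvg_ex; eexists; exact: cn.
exists m => // p /= mp.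
rewrite (sub_series_geq _ mp) (le_trans (ler_norm_sum _ _ _))//.
apply: (@le_trans _ _ (series c p - series c m)).
  by rewrite (sub_series_geq _ mp) ler_sum.
by rewrite lerD2r nondecreasing_cvgn_le.
Qed.

Lemma normc_le_Re_Im (z : R[i]) :
  `|z| <= (`|complex.Re z| + `|complex.Im z|)%:C%C.
Proof.
rewrite normc_def lecR -[leRHS]ger0_norm ?addr_ge0// -sqrtr_sqr ler_wsqrtr//.
rewrite sqrrD !real_normK ?num_real// lerD2r lerDl.
by rewrite mulrn_wge0// mulr_ge0.
Qed.

Lemma normc_ge_Im (z : R[i]) : `|complex.Im z|%:C%C <= `|z|.
Proof. by rewrite normc_def lecR -sqrtr_sqr ler_wsqrtr// lerDr sqr_ge0. Qed.

(** In the partial order of [R[i]], positive elements are real. This turns the complex tolerance of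
    a limit statement into a real one. *)
Lemma real_gt0P (d : R[i]) : 0 < d -> exists2 d' : R, 0 < d' & d = d'%:C%C.
Proof.
by case: d => a b; rewrite ltcE /= => /andP[/eqP -> a0]; exists a.
Qed.

(** The real and imaginary parts are summed separately, each with error at most the tail of [c];
    hence the factor 2. The bound depends on [c] alone, so it is uniform over all [x] dominated by
    [c]. *)
Lemma series_dominated_tail (x : nat -> R[i]) (c : nat -> R) :
  (forall k, `|x k| <= (c k)%:C%C) -> cvgn (series c) ->
  exists l : R[i], forall m,
    `|l - series x m| <= ((limn (series c) - series c m) *+ 2)%:C%C.
Proof.
move=> xc cc.
have Rec k : `|complex.Re (x k)| <= c k.
  by rewrite -lecR (le_trans (normc_ge_Re _)).
have Imc k : `|complex.Im (x k)| <= c k.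
  by rewrite -lecR (le_trans (normc_ge_Im _)).
have tR := series_tail_le Rec cc.
have tI := series_tail_le Imc cc.
exists (complex.Complex (limn (series (fun k => complex.Re (x k))))
                (limn (series (fun k => complex.Im (x k))))) => m.
apply: (le_trans (normc_le_Re_Im _)).
rewrite lecR mulr2n lerD// raddfB /= ?Re_series ?Im_series.
  exact: tR.
exact: tI.
Qed.

Lemma lt_split3 (a b c z : R[i]) (d : R) :
  `|a - b| < (d / 3)%:C%C -> `|b - c| < (d / 3)%:C%C ->
  `|z - c| < (d / 3)%:C%C -> `|a - z| < d%:C%C.
Proof.
move=> ab bc cz; have -> : d = d / 3 + (d / 3 + d / 3) by field.
rewrite !rmorphD -(subrKA b) (le_lt_trans (ler_normD _ _))// ltrD//.
rewrite -(subrKA c) (le_lt_trans (ler_normD _ _))// ltrD//.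
by rewrite distrC.
Qed.

(** * Limits of sums, products and powers of matrices *)

Lemma cvg_sum (I : Type) (s : seq I) (f : I -> nat -> R[i]) (a : I -> R[i]) :
  (forall i, f i k @[k --> \oo] --> a i) ->
  \sum_(i <- s) f i k @[k --> \oo] --> \sum_(i <- s) a i.
Proof.
move=> fa; apply: cvg_big => //.
exact: add_continuous.
Qed.

Lemma cvg_mulmx m n p (A : nat -> 'M[R[i]]_(m, n)) (B : nat -> 'M[R[i]]_(n, p))
    (A0 : 'M[R[i]]_(m, n)) (B0 : 'M[R[i]]_(n, p)) :
  A @ \oo --> A0 -> B @ \oo --> B0 -> A k *m B k @[k --> \oo] --> A0 *m B0.
Proof.
move=> /cvg_mxP AA /cvg_mxP BB; apply/cvg_mxP => i j; rewrite mxE.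
under eq_cvg do rewrite mxE.
by apply: cvg_sum => l; apply: cvgM; [exact: AA|exact: BB].
Qed.

Lemma cvg_exprmx n (A : nat -> 'M[R[i]]_n) (A0 : 'M[R[i]]_n) p :
  A @ \oo --> A0 -> A k ^+ p @[k --> \oo] --> A0 ^+ p.
Proof.
move=> AA; elim: p => [|p IH]; first by under eq_cvg do rewrite expr0; exact: cvg_cst.
by rewrite exprS; under eq_cvg do rewrite exprS; exact: cvg_mulmx.
Qed.

Lemma cvg_scalemx m n (c : R[i]) (A : nat -> 'M[R[i]]_(m, n)) (A0 : 'M[R[i]]_(m, n)) :
  A @ \oo --> A0 -> c *: A k @[k --> \oo] --> c *: A0.
Proof.
move=> /cvg_mxP AA; apply/cvg_mxP => i j; rewrite mxE.
under eq_cvg do rewrite mxE.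
by apply: cvgM; [exact: cvg_cst|exact: AA].
Qed.

(** * Continuity of the matrix exponential and of [nu] *)

(** An entry of [A *m A ^+ p] is a sum of [n] products, so each multiplication costs a factor
    [n%:R * M]. *)
Lemma exprmx_le n (A : 'M[R[i]]_n) (M : R) p :
  0 <= M -> (forall i j, `|A i j| <= M%:C%C) ->
  forall i j, `|(A ^+ p) i j| <= ((n%:R * M) ^+ p)%:C%C.
Proof.
move=> M0 AM; elim: p => [|p IH] i j.
  by rewrite !expr0 mxE; case: (_ == _); rewrite ?normr1 ?normr0 ?ler01.
rewrite exprS mxE (le_trans (ler_norm_sum _ _ _))//.
apply: (@le_trans _ _ (\sum_(l < n) (M * (n%:R * M) ^+ p)%:C%C)).
  by apply: ler_sum => l _; rewrite normrM rmorphM ler_pM.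
by rewrite sumr_const card_ord -rmorphMn lecR exprS -mulrA [leRHS]mulr_natl.
Qed.

Definition exp_term n (A : 'M[R[i]]_n) k := (k`!%:R)^-1 *: A ^+ k.

Lemma exp_term_le n (A : 'M[R[i]]_n) (M : R) k i j :
  0 <= M -> (forall i j, `|A i j| <= M%:C%C) ->
  `|exp_term A k i j| <= (exp_coeff (n%:R * M) k)%:C%C.
Proof.
move=> M0 AM; rewrite mxE normrM mulrC /exp_coeff /= rmorphM ler_pM// ?exprmx_le//.
by rewrite normfV normr_nat fmorphV rmorph_nat.
Qed.

Lemma series_mxE n (f : nat -> 'M[R[i]]_n) m i j :
  series f m i j = series (fun k => f k i j) m.
Proof. by rewrite !seriesEnat /= summxE. Qed.

Lemma cvg_series_mx n (f : nat -> nat -> 'M[R[i]]_n) (a : nat -> 'M[R[i]]_n) m :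
  (forall p, f k p @[k --> \oo] --> a p) ->
  series (f k) m @[k --> \oo] --> series a m.
Proof.
move=> fa; apply/cvg_mxP => i j; rewrite series_mxE.
under eq_cvg do rewrite series_mxE.
by apply: cvg_sum => p; exact: (cvg_mxP _ _).1 (fa p) i j.
Qed.

Lemma cvg_partial_expmx n (A : nat -> 'M[R[i]]_n) (A0 : 'M[R[i]]_n) :
  A @ \oo --> A0 ->
  forall m, series (exp_term (A k)) m @[k --> \oo] --> series (exp_term A0) m.
Proof.
move=> AA m; apply: cvg_series_mx => p.
by apply: cvg_scalemx; exact: cvg_exprmx.
Qed.

Lemma cvg_tail n (c : nat -> R) : cvgn (series c) ->
  (limn (series c) - series c k) *+ n @[k --> \oo] --> (0 : R).
Proof.
move=> cc; rewrite -(mul0rn R n) -(subrr (limn (series c))).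
by apply: cvgMn; apply: cvgB => //; exact: cvg_cst.
Qed.

(** The entries of the exponential series are dominated by the real series of exp(nM), so the error
    is uniform over all [A] with entries bounded by [M]. *)
Lemma expmx_tail n (A : 'M[R[i]]_n) (M : R) :
  0 <= M -> (forall i j, `|A i j| <= M%:C%C) ->
  forall m i j, `|expmx A i j - series (exp_term A) m i j| <=
    ((limn (series (exp_coeff (n%:R * M))) -
      series (exp_coeff (n%:R * M)) m) *+ 2)%:C%C.
Proof.
move=> M0 AM; set c := exp_coeff _.
have cc : cvgn (series c) by exact: is_cvg_series_exp_coeff.
have /choice[l Hl] : forall ij : 'I_n * 'I_n, exists l : R[i], forall m,
    `|l - series (fun k => exp_term A k ij.1 ij.2) m| <=
    ((limn (series c) - series c m) *+ 2)%:C%C.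
  by move=> [i j]; apply: series_dominated_tail => // k; exact: exp_term_le.
have lP i j : series (fun k => exp_term A k i j) @ \oo --> l (i, j).
  apply/cvgrPdist_lt => _ /real_gt0P[d d0 ->].
  have /cvgrPdist_lt /(_ d d0) := cvg_tail 2 cc.
  apply: filterS => k; rewrite sub0r normrN => kd.
  apply: le_lt_trans (Hl (i, j) k) _.
  by rewrite ltcR; apply: le_lt_trans kd; exact: ler_norm.
(* [expmx] is a [limn], which is meaningful only once the series is known to converge; the entrywise
   limits [l] provide this. *)
have expA : series (exp_term A) @ \oo --> expmx A.
  apply/cvg_ex; exists (\matrix_(i, j) l (i, j)); apply/cvg_mxP => i j.
  by rewrite mxE; under eq_cvg do rewrite series_mxE; exact: lP.
move=> m i j.
have -> : expmx A i j = l (i, j).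
  apply: (cvg_unique _ _ (lP i j)); first exact: norm_hausdorff.
  by have /cvg_mxP/(_ i j) := expA; under eq_cvg do rewrite series_mxE.
by rewrite series_mxE; exact: Hl.
Qed.

(** A three-term estimate: both exponentials are replaced by their partial sums of a common length
    [m], and these partial sums are continuous in the matrix. *)
Lemma cvg_expmx n (A : nat -> 'M[R[i]]_n) (A0 : 'M[R[i]]_n) :
  A @ \oo --> A0 -> expmx (A k) @[k --> \oo] --> expmx A0.
Proof.
move=> AA.
have [r r0 rE] : exists2 r : 'I_n -> 'I_n -> R,
    (forall i j, 0 <= r i j) & forall i j, `|A0 i j| = (r i j)%:C%C.
  by exists (fun i j => complex.Re `|A0 i j|) => i j; rewrite normc_def// sqrtr_ge0.
(* The sum bounds every entry of [A0]; the extra 1 absorbs the distance from [A k] to [A0] for large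
   [k]. *)
pose M : R := 1 + \sum_i \sum_j r i j.
have M0 : 0 <= M.
  by rewrite addr_ge0// sumr_ge0// => i _; rewrite sumr_ge0.
have A0M i j : `|A0 i j| + 1 <= M%:C%C.
  rewrite rE addrC -(rmorph1 (real_complex R)) -rmorphD lecR lerD2l.
  rewrite (bigD1 i)//= (bigD1 j)//= -addrA lerDl.
  by apply: addr_ge0; apply: sumr_ge0 => k _ //; exact: sumr_ge0.
have AM : \forall k \near \oo, forall i j, `|A k i j| <= M%:C%C.
  apply: filter_forall => i; apply: filter_forall => j.
  have /cvg_mxP/(_ i j)/cvgrPdist_lt/(_ 1 ltr01) := AA.
  apply: filterS => k Ak; apply: le_trans (A0M i j).
  rewrite -[A k i j](subKr (A0 i j)) (le_trans (ler_normB _ _))// lerD2l.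
  exact: ltW.
have A0M' i j : `|A0 i j| <= M%:C%C by apply: le_trans (A0M i j); rewrite lerDl.
apply/cvg_mxP => i j; apply/cvgrPdist_lt => _ /real_gt0P[d d0 ->].
have cc : cvgn (series (exp_coeff (n%:R * M))) by exact: is_cvg_series_exp_coeff.
have d3 : 0 < d / 3 by rewrite divr_gt0.
(* The length [m] depends only on [M] and [d], so it is fixed before [k]. *)
have /cvgrPdist_lt /(_ _ d3) [m _ /(_ m (leqnn m))] := cvg_tail 2 cc.
rewrite sub0r normrN => /(le_lt_trans (ler_norm _)) tm.
have Sm : series (exp_term (A k)) m i j @[k --> \oo] --> series (exp_term A0) m i j.
  by have /cvg_mxP/(_ i j) := cvg_partial_expmx (m := m) AA.
have d3C : 0 < (d / 3)%:C%C :> R[i] by rewrite ltcR.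
have /cvgrPdist_lt /(_ _ d3C) Smd := Sm.
near=> k.
have tk : `|expmx (A k) i j - series (exp_term (A k)) m i j| < (d / 3)%:C%C.
  apply: le_lt_trans (expmx_tail M0 _ m i j) _; last by rewrite ltcR.
  by near: k.
have t0 : `|expmx A0 i j - series (exp_term A0) m i j| < (d / 3)%:C%C.
  by apply: le_lt_trans (expmx_tail M0 A0M' m i j) _; rewrite ltcR.
have ts : `|series (exp_term A0) m i j - series (exp_term (A k)) m i j| < (d / 3)%:C%C.
  by near: k.
exact: lt_split3 t0 ts tk.
Unshelve. all: by end_near. Qed.

Lemma cvg_hdot n (u : 'cV[R[i]]_n) (w : nat -> 'cV[R[i]]_n) (w0 : 'cV[R[i]]_n) :
  w @ \oo --> w0 -> hdot u (w k) @[k --> \oo] --> hdot u w0.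
Proof.
move=> /cvg_mxP ww; rewrite hdotE; under eq_cvg do rewrite hdotE.
apply: cvg_sum => i; apply: cvgM; first exact: cvg_cst.
(* Conjugation preserves distances, so it preserves the limit. *)
have /cvgrPdist_lt wi := ww i 0.
apply/cvgrPdist_lt => d /wi; apply: filterS => k.
by rewrite -rmorphB norm_conjC.
Qed.

Lemma cvg_nu n (u v : 'cV[R[i]]_n) (A : nat -> 'M[R[i]]_n) (A0 : 'M[R[i]]_n) :
  A @ \oo --> A0 -> nu u v (A k) @[k --> \oo] --> nu u v A0.
Proof.
move=> AA; apply: cvg_norm; apply: cvg_hdot; apply: cvg_mulmx (cvg_cst _).
by apply: cvg_expmx; exact: cvg_scalemx.
Qed.

End ExponentialContinuity.

Section CompactSupport.
Set Implicit Arguments.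
Unset Strict Implicit.
Context {R : realType}.

(** * Extraction of convergent subsequences *)

Lemma cvgn_harmonic_le (f : nat -> R) :
  (forall k, 0 <= f k <= k.+1%:R^-1) -> f @ \oo --> (0 : R).
Proof.
move=> f_le; apply: (@squeeze_cvgr _ _ _ _ (cst 0) (fun k => k.+1%:R^-1)).
- by near=> k; exact: f_le.
- exact: cvg_cst.
- exact: cvg_harmonic.
Unshelve. all: by end_near. Qed.

(** Compactness gives a cluster point [l], and [phi k] is an index at least [k] whose term lies
    within 1/(k+1) of [l]. Such a [phi] tends to infinity but need not be increasing, which suffices
    for composing limits. *)
Lemma precompact_subseq (C : set R[i]) (x : nat -> R[i]) :
  precompact C -> (\forall k \near \oo, C (x k)) ->
  exists2 phi : nat -> nat, phi @ \oo --> \oo &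
    exists l : R[i], x (phi k) @[k --> \oo] --> l.
Proof.
move=> [B CB [cB _]] Cx.
have Bx : (x @ \oo) B by apply: filterS Cx => k; exact: CB.
have [l [Bl xl]] := cB _ _ Bx.
have /choice[phi Hphi] : forall k : nat, exists p : nat,
    (k <= p)%N /\ `|l - x p| < (k.+1%:R^-1 : R)%:C%C.
  move=> k; have [] := xl (x @` [set p | (k <= p)%N])
    [set z | `|l - z| < (k.+1%:R^-1 : R)%:C%C].
  - by exists k => // p /= kp; exists p.
  - apply/nbhs_ballP; exists (k.+1%:R^-1 : R)%:C%C.
      by rewrite /= ltcR invr_gt0.
    by move=> z; rewrite -ball_normE.
  - by move=> _ [[p /= kp <-] lp]; exists p.
exists phi.
  apply/cvgnyPge => N; exists N => // k /= Nk.
  by apply: leq_trans Nk _; exact: (Hphi k).1.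
exists l; apply/cvgrPdist_lt => _ /real_gt0P[d d0 ->].
have /cvgrPdist_lt/(_ d d0) := @cvg_harmonic R; apply: filterS => k /=.
rewrite sub0r normrN ger0_norm ?invr_ge0// => kd.
by apply: lt_trans (Hphi k).2 _; rewrite ltcR.
Qed.

Variable K : scalar_field.

(** Relative compactness is given for some representative [z]; the limit found along [z] passes to
    [y], as the two differ by a null net. *)
Lemma compactly_supported_subseq (p : gen_num R K) (y : eps01 R -> R[i])
    (eps_ : nat -> eps01 R) :
  compactly_supported p -> represents y p ->
  (fun k => val (eps_ k)) @ \oo --> (0 : R) ->
  exists2 phi : nat -> nat, phi @ \oo --> \oo &
    exists l : R[i], y (eps_ (phi k)) @[k --> \oo] --> l.
Proof.
move=> [z zp [eta eta0 pz]] yp e0.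
have [|phi phioo [l zl]] := precompact_subseq (x := fun k => z (eps_ k)) pz.
  apply: (@small_eps_cvg _ (fun e => [set z e | e in [set e | val e < eta]] (z e))) e0 _.
  by exists eta => // e ee; exists e.
exists phi => //; exists l.
apply: (net_cvg_represents (eps_ := eps_ \o phi) zp yp) => //.
exact: cvg_comp phioo e0.
Qed.

Lemma mx_compactly_supported_subseq m n (A : 'M[gen_num R K]_(m, n))
    (A_ : eps01 R -> 'M[R[i]]_(m, n)) (eps_ : nat -> eps01 R) :
  (forall i j, compactly_supported (A i j)) -> mx_represents A_ A ->
  (fun k => val (eps_ k)) @ \oo --> (0 : R) ->
  exists2 phi : nat -> nat, phi @ \oo --> \oo &
    exists A0 : 'M[R[i]]_(m, n), A_ (eps_ (phi k)) @[k --> \oo] --> A0.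
Proof.
move=> cA AA e0.
(* Subsequences are extracted for one entry after another; each further extraction keeps the limits
   already obtained. *)
have [phi phioo Hphi] : exists2 phi : nat -> nat, phi @ \oo --> \oo &
    forall ij, ij \in enum {: 'I_m * 'I_n} ->
      exists l : R[i], A_ (eps_ (phi k)) ij.1 ij.2 @[k --> \oo] --> l.
  elim: (enum _) => [|[i j] s [phi phioo IH]]; first by exists id.
  have e0' : (fun k => val (eps_ (phi k))) @ \oo --> (0 : R).
    exact: cvg_comp phioo e0.
  have [psi psioo [l Al]] := compactly_supported_subseq (cA i j) (AA i j) e0'.
  exists (phi \o psi); first exact: cvg_comp psioo phioo.
  move=> ij; rewrite inE => /predU1P[->|/IH[l' Al']]; first by exists l.
  by exists l'; exact: (cvg_comp _ _ psioo Al').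
have /choice[l Hl] ij : exists l : R[i], A_ (eps_ (phi k)) ij.1 ij.2 @[k --> \oo] --> l.
  by apply: Hphi; rewrite mem_enum.
exists phi => //; exists (\matrix_(i, j) l (i, j)); apply/cvg_mxP => i j.
by rewrite mxE; exact: Hl (i, j).
Qed.

(** * Moderateness of the net [nu u v (A_ e)] *)

Lemma not_small_eps (P : eps01 R -> Prop) : ~ small_eps P ->
  exists2 eps_ : nat -> eps01 R, (fun k => val (eps_ k)) @ \oo --> (0 : R) &
    forall k, ~ P (eps_ k).
Proof.
move=> nP.
have /choice[eps_ He] (k : nat) : exists e : eps01 R, val e < k.+1%:R^-1 /\ ~ P e.
  apply: contrapT => H; apply: nP; exists k.+1%:R^-1; first by rewrite invr_gt0.
  by move=> e ek; apply: contrapT => nPe; apply: H; exists e.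
exists eps_ => [|k]; last exact: (He k).2.
by apply: cvgn_harmonic_le => k; rewrite ltW ?eps_gt0//= ltW//; exact: (He k).1.
Qed.

Lemma ball1_normc_bound (y : R[i]) :
  exists2 b : R, 0 < b & forall z, `|y - z| < 1 -> `|z| <= b%:C%C.
Proof.
exists (complex.Re `|y| + 1); first by rewrite ltr_wpDl// normc_def sqrtr_ge0.
have yE : `|y| = (complex.Re `|y|)%:C%C by rewrite normc_def.
move=> z yz; rewrite (rmorphD (real_complex R)) /= rmorph1 -yE.
rewrite -[z in leLHS](subKr y) (le_trans (ler_normB _ _))// lerD2l.
exact: ltW.
Qed.

Lemma nu_represents n (u v : 'cV[R[i]]_n) (A : 'M[gen_num R K]_n)
    (A_ : eps01 R -> 'M[R[i]]_n) :
  (forall i j, compactly_supported (A i j)) -> mx_represents A_ A ->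
  exists nuA : gen_num R RealScalars,
    represents (fun e => nu u v (A_ e)) nuA.
Proof.
move=> cA AA.
suff nuM : (fun e => nu u v (A_ e)) \in moderate RealScalars.
  pose nu_net : moderate_net R RealScalars :=
    exist (fun x => x \in @moderate R RealScalars) _ nuM.
  by eexists; exists nu_net.
apply/moderateP; split=> [e|]; first exact: normr_real.
(* Exponent 1 is enough: if the net exceeded 1/e along a sequence tending to 0, it would be
   unbounded on every subsequence, yet it converges on one. *)
exists 1%N; apply: contrapT => /not_small_eps[eps_ e0 He].
have [phi phioo [A0 AA0]] := mx_compactly_supported_subseq cA AA e0.
have /cvgrPdist_lt/(_ 1 ltr01) nu1 := cvg_nu (u := u) (v := v) AA0.
have e0' : (fun k => val (eps_ (phi k))) @ \oo --> (0 : R).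
  exact: cvg_comp phioo e0.
have [b b0 nub] := ball1_normc_bound (nu u v A0).
(* Once [eps_ (phi k)] is below [b^-1], its inverse exceeds the bound [b], contradicting [He]. *)
have bV0 : 0 < b^-1 by rewrite invr_gt0.
have /cvgrPdist_lt/(_ _ bV0) eb := e0'.
have [k [/nub nuk ke]] := @filter_ex _ _ _ _ (filterI nu1 eb).
apply: (He (phi k)); apply: le_trans nuk _.
rewrite lecR expr1 -[leLHS]invrK lef_pV2 ?posrE ?eps_gt0//.
by move: ke => /=; rewrite sub0r normrN gtr0_norm ?eps_gt0// => /ltW.
Qed.

End CompactSupport.

Theorem theorem5p11 (R : realType) (K : scalar_field) (n : nat)
    (A : 'M[gen_num R K]_n) (A_ : eps01 R -> 'M[R[i]]_n)
    (u v : 'cV[R[i]]_n) :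
  (forall i j, compactly_supported (A i j)) ->
  gen_hermitian A ->
  mx_represents A_ A ->
  (forall e : eps01 R, A_ e \is hermsymmx) ->
  hdot u v = 0 -> vnorm u = 1 -> vnorm v = 1 ->
  exists2 nuA : gen_num R RealScalars,
    represents (fun e => nu u v (A_ e)) nuA &
    gen_supp nuA = nu u v @` mx_supp A.
Proof.
move=> cA _ AA _ _ _ _.
have [nuA nuAP] := nu_represents u v cA AA.
(* Supports do not depend on the representative, so both are computed on the given nets. *)
exists nuA => //; rewrite (gen_suppE nuAP) (mx_suppE AA).
apply/seteqP; split=> [q [eps_ e0 nuq]|_ [A0 [eps_ e0 AA0] <-]]; last first.
  by exists eps_ => //; exact: cvg_nu.
(* The matrices converge to some [A0] along a subsequence; there [nu] tends both to [nu u v A0] and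
   to [q], and limits are unique. *)
have [phi phioo [A0 AA0]] := mx_compactly_supported_subseq cA AA e0.
exists A0; first by exists (eps_ \o phi) => //; exact: cvg_comp phioo e0.
have nu0 := cvg_nu (u := u) (v := v) AA0.
have nuq' : nu u v (A_ (eps_ (phi k))) @[k --> \oo] --> q.
  exact: (cvg_comp _ _ phioo nuq).
exact: (cvg_unique _ nu0 nuq').
Qed.
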